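(* Let $P$ be an oriented forest of $q$ virtual edges on vertices of $G$ (the virtual edges need not be physical edges of $G$). Let $D_P$ be its reduced incidence matrix after grounding $g$, and put $$Z_P=D_P^TK^{-1}D_P,\qquad \mathcal L_P=Z_P^{-1}.$$ For each spanning forest $F$ of $G$, let $H_F^P$ be the quotient virtual-port multigraph, $B_F^P=Q_FD_P$, and $\chi_F^P(S)=\det B_F^P[:,S]$. Then for all $A,B\subseteq E(P)$ with $|A|=|B|=r$, $$\det Z_P[A,B]=\frac{1}{\tau_c(G)}\sum_{F\in\mathcal F_{r+1}}\chi_F^P(A)\,\chi_F^P(B)\,w(F).$$ Let $$\Phi_P:=\sum_{\substack{F\in\mathcal F_{q+1}\\ E(P)\text{ is a spanning tree of }H_F^P}}w(F).$$ For $I,J\subseteq E(P)$ with $|I|=|J|=k$ and $r=q-k$, and for $F\in\mathcal F_{r+1}$, let $$\widehat\chi_F^P(I):=\det\begin{pmatrix}B_F^P \\ E_I^T\end{pmatrix}.$$ Then $$\det\mathcal L_P[I,J]=\frac{1}{\Phi_P}\sum_{F\in\mathcal F_{r+1}}\widehat\chi_F^P(I)\,\widehat\chi_F^P(J)\,w(F).$$ All coefficients ($\chi_F^P(A)\chi_F^P(B)$ and $\widehat\chi_F^P(I)\widehat\chi_F^P(J)$) are $0$ or $\pm1$, and a completed determinant $\widehat\chi_F^P(I)$ is nonzero exactly when its complementary virtual-edge set $E(P)\setminus I$ is a spanning tree of $H_F^P$.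
   Context: Network. $G=(V,E)$ is a finite connected simple undirected graph; each edge $e$ has a conductance $c_e\in\mathbb R_{>0}$. The weighted Laplacian $L_c$ is the $V\times V$ matrix with $(L_c)_{uu}=\sum_{e\ni u}c_e$, $(L_c)_{uv}=-c_{uv}$ if $uv\in E$, and $0$ otherwise. Fix a ground vertex $g\in V$ and let $K=L_c[V\setminus\{g\},V\setminus\{g\}]$. A spanning forest $F$ of $G$ is an acyclic subgraph with vertex set $V$ (isolated vertices allowed); $w(F)=\prod_{e\in F}c_e$; $\mathcal F_m$ is the set of spanning forests of $G$ with exactly $m$ connected components. $\tau_c(G)=\sum_T\prod_{e\in T}c_e$, the sum over spanning trees $T$ of $G$. Matrix conventions. $A[S,T]$ is the submatrix with rows $S$ and columns $T$ in inherited order; $A[:,T]$ keeps all rows; empty determinants equal $1$. Virtual dipoles. $P$ is an acyclic graph whose vertices are vertices of $G$, with $q$ oriented edges listed in a fixed order $E(P)$; its edges are arbitrary vertex pairs of $G$. With $(e_v)$ the standard basis of $\mathbb R^{V\setminus\{g\}}$ and $e_g=0$, the reduced incidence matrix $D_P$ has, for each virtual edge oriented from $u$ to $v$, the column $e_v-e_u$, in the fixed order. Quotients. For a spanning forest $F$ of $G$ with $s\ge1$ components, let $C_0(F)$ be the component containing $g$ and order the others as $C_1(F),\dots,C_{s-1}(F)$. The multigraph $H_F^P$ has the components of $F$ as vertices, and each virtual edge from $u$ to $v$ gives a directed edge from the component containing $u$ to the component containing $v$ (a loop if these coincide). $Q_F$ is the $(s-1)\times(|V|-1)$ matrix with columns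 indexed by $V\setminus\{g\}$ and $(Q_F)_{a,v}=1$ if $v\in C_a(F)$, $0$ otherwise ($1\le a\le s-1$). $\chi_F^P(S)$ is defined for $S\subseteq E(P)$ with $|S|=s-1$, with $\chi_F^P(\varnothing)=1$ when $s=1$. For $I\subseteq E(P)$ with $|I|=k$, $E_I$ is the $q\times k$ matrix whose columns are the standard basis vectors of $\mathbb R^{E(P)}$ indexed by $I$, in the inherited virtual-edge order. *)

(* Defs.v *)
From mathcomp Require Import all_boot all_order all_algebra.

Set Implicit Arguments.
Unset Strict Implicit.
Unset Printing Implicit Defensive.

Import Order.TTheory GRing.Theory Num.Theory.
Local Open Scope ring_scope.

(* An undirected multigraph is an endpoint map [ends : I -> {set W}] from edge
   names to sets of one (loop) or two vertices, together with a vertex set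
   [X : {set W}]; a spanning subgraph is a set [S] of edge names.  A simple
   graph has its 2-subsets of vertices as edge names, and [ends := id]. *)
Section Multigraph.
Variables (W I : finType) (ends : I -> {set W}).

Definition mg_adj (S : {set I}) : rel W :=
  fun x y => [exists i in S, ends i == [set x; y]].

Definition mg_connected (X : {set W}) (S : {set I}) : bool :=
  [forall x in X, forall y in X, connect (mg_adj S) x y].

(* The cycle x_0 -i_0- x_1 -i_1- ... x_(n-1) -i_(n-1)- x_0, n > 0, is the list
   of the pairs (x_k, i_k); n = 1 is a loop, n = 2 a pair of parallel edges. *)
Definition mg_cycle (S : {set I}) (s : seq (W * I)) : bool :=
  [&& s != [::], uniq (unzip1 s), uniq (unzip2 s), all (mem S) (unzip2 s)
    & cycle (fun p p' => ends p.2 == [set p.1; p'.1]) s].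

Definition mg_acyclic (S : {set I}) : bool :=
  [forall n : 'I_#|I|.+1, forall t : n.-tuple (W * I), ~~ mg_cycle S t].

(* The edges of a cycle are distinct, so the length bound is harmless. *)
Lemma mg_acyclicP (S : {set I}) :
  reflect (forall s, ~~ mg_cycle S s) (mg_acyclic S).
Proof.
apply: (iffP idP) => [acS s|acS]; last by do 2!apply/forallP=> ?.
apply/negP=> cs; have /and5P[_ _ us _ _] := cs.
have ltsI : (size s < #|I|.+1)%N.
  by rewrite ltnS -(size_map snd) -(card_uniqP us) max_card.
by move/forallP/(_ (Ordinal ltsI))/forallP/(_ (in_tuple s)): acS; rewrite cs.
Qed.

Definition mg_spanning_tree (X : {set W}) (S : {set I}) : bool :=
  mg_connected X S && mg_acyclic S.

End Multigraph.

Section Network.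
Variables (V : finType) (E : {set {set V}}).

Definition simple_graph : Prop := forall f, f \in E -> #|f| = 2%N.

Definition component (F : {set {set V}}) (v : V) : {set V} :=
  [set x | connect (mg_adj id F) v x].

Definition components (F : {set {set V}}) : {set {set V}} :=
  [set component F v | v in V].

Definition spanning_forest (F : {set {set V}}) : bool :=
  (F \subset E) && mg_acyclic id F.

Definition forests (m : nat) : {set {set {set V}}} :=
  [set F | spanning_forest F & #|components F| == m].

(* [s] lists the components C_0, C_1, ... of [F], with [g] in C_0. *)
Definition component_order (g : V) (F : {set {set V}}) (s : seq {set V}) :=
  perm_eq s (enum (components F)) && (g \in nth set0 s 0).

Variables (R : realFieldType) (c : {set V} -> R).

Definition weight (F : {set {set V}}) : R := \prod_(f in F) c f.

Definition tau : R :=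
  \sum_(T : {set {set V}} | (T \subset E) && mg_spanning_tree id [set: V] T)
     weight T.

Definition laplacian (u v : V) : R :=
  if u == v then \sum_(f in E | u \in f) c f
  else if [set u; v] \in E then - c [set u; v] else 0.

(* Rows and columns indexed by V \ {g} are numbered by [enum_val]. *)
Definition grounded_laplacian (g : V) : 'M[R]_#|[set~ g]| :=
  \matrix_(a, b) laplacian (enum_val a) (enum_val b).

End Network.

(* For a set of ordinals, [enum_val] is increasing: [sel hA] is the inherited
   order on [A]. *)
Definition sel (q r : nat) (A : {set 'I_q}) (hA : #|A| = r) (i : 'I_r) : 'I_q :=
  enum_val (cast_ord (esym hA) i).

Section Dipoles.
Variables (V : finType) (q : nat) (P : 'I_q -> V * V).

Definition virtual_ends (i : 'I_q) : {set V} := [set (P i).1; (P i).2].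

Definition quotient_arc (F : {set {set V}}) (i : 'I_q) : {set V} * {set V} :=
  (component F (P i).1, component F (P i).2).

Definition quotient_ends (F : {set {set V}}) (i : 'I_q) : {set {set V}} :=
  [set (quotient_arc F i).1; (quotient_arc F i).2].

Definition quotient_spanning_tree (F : {set {set V}}) (S : {set 'I_q}) : bool :=
  mg_spanning_tree (quotient_ends F) (components F) S.

Variables (R : realFieldType) (g : V).

(* This is 0 for v = g. *)
Definition std_vec (v : V) : 'cV[R]_#|[set~ g]| :=
  \col_a (enum_val a == v)%:R.

Definition incidence : 'M[R]_(#|[set~ g]|, q) :=
  \matrix_(a, j) (std_vec (P j).2 - std_vec (P j).1) a 0.

Variables (E : {set {set V}}) (c : {set V} -> R).

Definition impedance : 'M[R]_q :=
  incidence^T *m invmx (grounded_laplacian E c g) *m incidence.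

Definition Phi : R :=
  \sum_(F in forests E q.+1 | quotient_spanning_tree F [set: 'I_q]) weight c F.

(* [s] is the ordered list of the components of a forest; the number of rows
   [r] is meant to be [(size s).-1]. *)
Definition quotient_mx (r : nat) (s : seq {set V}) : 'M[R]_(r, #|[set~ g]|) :=
  \matrix_(a, v) (enum_val v \in nth set0 s a.+1)%:R.

Definition boundary_mx (r : nat) (s : seq {set V}) : 'M[R]_(r, q) :=
  quotient_mx r s *m incidence.

Definition chi (s : seq {set V}) (r : nat) (A : {set 'I_q})
    (hA : #|A| = r) : R :=
  \det (colsub (sel hA) (boundary_mx r s)).

Definition basis_mx (k : nat) (I : {set 'I_q}) (hI : #|I| = k) : 'M[R]_(q, k) :=
  \matrix_(i, j) (i == sel hI j)%:R.

Definition chihat (s : seq {set V}) (r k : nat) (hrk : (r + k)%N = q)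
    (I : {set 'I_q}) (hI : #|I| = k) : R :=
  \det (castmx (hrk, erefl q) (col_mx (boundary_mx r s) (basis_mx hI)^T)).

End Dipoles.

(* Main.v *)
(* The grounded Laplacian is [K = N diag(c) N^T], where the columns of [N] are
   the reduced boundaries [n_e] of the edges.  Completing [D_A] and [D_B] to bases,
   Jacobi's complementary minor identity and Cauchy-Binet give
     [det K * det (D_A^T K^-1 D_B) =
        \sum_F w(F) * det [D_A | N_F] * det [D_B | N_F]],
   the sum being over edge sets [F] with [|F| = |V| - 1 - r].  The columns [N_F]
   are dependent unless [F] is acyclic, that is, a forest with [r + 1]
   components.  For such [F] we have [Q_F N_F = 0], whence
   [det [D_A | N_F] = e_F * chi_F(A)]; the sign [e_F] is the determinant of
   [[D_0 | N_F]], where [D_0] joins [g] to one vertex of every other component.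
   The signs cancel in the product.  The case [r = 0] reads [tau = det K], and
   [r = q] reads [Phi = tau * det Z].  The minors of [L = Z^-1] follow by
   applying Jacobi's identity once more, in bases permuted by [I] and [J].

   Determinants of incidence matrices are 0 or +-1 by total unimodularity, and
   one is nonzero exactly when its graph is connected and acyclic: a potential
   constant along the edges of a connected graph and zero at the ground
   vanishes, whereas a cycle carries a nonzero circulation. *)

Require Import Defs.
From mathcomp Require Import all_boot all_order all_algebra all_fingroup ring.

Set Implicit Arguments.
Unset Strict Implicit.
Unset Printing Implicit Defensive.

Import Order.TTheory GRing.Theory Num.Theory.
Local Open Scope ring_scope.

(** * Determinants *)

(* Summing over all functions [f] counts each [n]-subset of indices [n`!]
   times. *)
Lemma Cauchy_Binet (R : comRingType) (n : nat) (I : finType)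
    (u v : I -> 'I_n -> R) :
  \det (\matrix_(a, b) \sum_i u i a * v i b) *+ n`! =
  \sum_(f : {ffun 'I_n -> I})
     \det (\matrix_(a, b) u (f b) a) * \det (\matrix_(a, b) v (f a) b).
Proof.
pose M (f : 'I_n -> I) : 'M_n := \matrix_(a, b) v (f a) b.
have detE : \det (\matrix_(a, b) \sum_i u i a * v i b) =
    \sum_(f : {ffun 'I_n -> I}) (\prod_a u (f a) a) * \det (M f).
  rewrite /determinant.
  under eq_bigr => s _.
    under eq_bigr => a _ do rewrite mxE.
    rewrite bigA_distr_bigA big_distrr /=.
    over.
  rewrite exchange_big /=; apply: eq_bigr => f _.
  rewrite big_distrr /=; apply: eq_bigr => s _.
  rewrite big_split /= mulrCA; congr (_ * (_ * _)).
  by apply: eq_bigr => a _; rewrite mxE.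
(* Reindexing by [s] permutes the rows of [M f] and leaves the sum unchanged. Summing over all [s]
   gives the factorial on one side and the Leibniz expansion of the [u]-determinant on the other. *)
have twist (s : 'S_n) :
    \sum_(f : {ffun 'I_n -> I}) (\prod_a u (f a) a) * \det (M f)
    = \sum_(f : {ffun 'I_n -> I})
        ((-1) ^+ s * \prod_a u (f (s a)) a) * \det (M f).
  rewrite (reindex (fun f : {ffun 'I_n -> I} => [ffun a => f (s a)])) /=; last first.
    exists (fun f : {ffun 'I_n -> I} => [ffun a => f (s^-1%g a)]) => f _;
    by apply/ffunP=> a; rewrite !ffunE (permK, permKV).
  apply: eq_bigr => f _.
  have -> : M [ffun a => f (s a)] = row_perm s (M f).
    by apply/matrixP=> a b; rewrite !mxE ffunE.
  rewrite row_permE det_mulmx det_perm mulrA; congr (_ * _).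
  rewrite mulrC; congr (_ * _).
  by apply: eq_bigr => a _; rewrite ffunE.
rewrite detE -card_Sn -sumr_const.
rewrite (eq_bigr (fun s : 'S_n => \sum_(f : {ffun 'I_n -> I})
        ((-1) ^+ s * \prod_a u (f (s a)) a) * \det (M f))); last by move=> s _.
rewrite (eq_bigl xpredT); last by move=> s; rewrite inE.
rewrite exchange_big /=; apply: eq_bigr => f _.
rewrite -big_distrl /=; congr (_ * _).
by apply: eq_bigr => s _; congr (_ * _); apply: eq_bigr => a _; rewrite mxE.
Qed.

(** Jacobi's complementary minor identity. Replacing the first block column of [H'] by that of the
    identity makes both this factor and its product with [H] block triangular; comparing
    determinants gives the claim. *)
Lemma det_ulsubmx_mul (R : comRingType) (r p : nat) (H H' : 'M[R]_(r + p)) :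
  H *m H' = 1%:M -> \det (ulsubmx H) = \det H * \det (drsubmx H').
Proof.
move=> HH'.
have HE : H *m col_mx (ursubmx H') (drsubmx H') = col_mx 0 1%:M.
  have -> : col_mx (ursubmx H') (drsubmx H') = rsubmx H'.
    rewrite -[RHS]vsubmxK; congr col_mx; by apply/matrixP=> i j; rewrite !mxE.
  by rewrite mulmx_rsub HH' scalar_mx_block block_mxEh row_mxKr.
have E : H *m block_mx 1%:M (ursubmx H') 0 (drsubmx H') =
         block_mx (ulsubmx H) 0 (dlsubmx H) 1%:M.
  rewrite block_mxEh mul_mx_row HE -[H in H *m col_mx _ _]hsubmxK mul_row_col.
  rewrite mulmx1 mulmx0 addr0 block_mxEh; congr row_mx.
  by rewrite -[LHS]vsubmxK; congr col_mx; apply/matrixP=> i j; rewrite !mxE.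
move/(congr1 determinant): E; rewrite det_mulmx det_ublock det_lblock.
by rewrite !det1 mul1r mulr1 => <-.
Qed.

(** By the rank normal form, [A] is an invertible matrix times the top rows of the invertible
    [row_ebase A], whose bottom rows complete it. *)
Lemma row_free_complete (F : fieldType) (r p : nat) (A : 'M[F]_(r, r + p)) :
  row_free A -> exists A' : 'M_(p, r + p), col_mx A A' \in unitmx.
Proof.
move=> /eqP rA; exists (dsubmx (row_ebase A)).
have {1}-> : A = col_ebase A *m usubmx (row_ebase A).
  rewrite -{1}[A]mulmx_ebase rA -mulmxA; congr (_ *m _).
  have -> : pid_mx r = row_mx 1%:M 0 :> 'M[F]_(r, r + p).
    exact: pid_mx_row.
  by rewrite -{1}[row_ebase A]vsubmxK mul_row_col mul1mx mul0mx addr0.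
suff -> : col_mx (col_ebase A *m usubmx (row_ebase A)) (dsubmx (row_ebase A)) =
    block_mx (col_ebase A) 0 0 1%:M *m row_ebase A.
  by rewrite unitmx_mul row_ebase_unit andbT unitmxE det_lblock det1 mulr1
    -unitmxE col_ebase_unit.
by rewrite -{3}[row_ebase A]vsubmxK mul_block_col !mul0mx addr0 add0r mul1mx.
Qed.

(* Complete [A] and [B] to invertible matrices: Jacobi's complementary minor
   identity turns the left-hand side into a minor of [K] in the dual bases, to
   which Cauchy-Binet applies. *)
Lemma det_inv_compression (F : fieldType) (r p : nat) (I : finType)
    (u v : I -> 'I_(r + p) -> F) (K : 'M[F]_(r + p))
    (A : 'M[F]_(r, r + p)) (B : 'M[F]_(r + p, r)) :
  K = \matrix_(a, b) \sum_i u i a * v i b -> K \in unitmx ->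
  row_free A -> row_free B^T ->
  (\det K * \det (A *m invmx K *m B)) *+ p`! =
  \sum_(f : {ffun 'I_p -> I})
     \det (row_mx B (\matrix_(a, b) u (f b) a)) *
     \det (col_mx A (\matrix_(a, b) v (f a) b)).
Proof.
move=> KE Ku /row_free_complete[A' Au] /row_free_complete[B' Bu].
set Ah := col_mx A A' in Au; set Bh := (col_mx B^T B')^T.
have {}Bu : Bh \in unitmx by rewrite /Bh unitmx_tr.
have BhE : Bh = row_mx B B'^T by rewrite /Bh tr_col_mx trmxK.
pose H := Ah *m invmx K *m Bh.
pose H' := invmx Bh *m K *m invmx Ah.
have HH' : H *m H' = 1%:M.
  rewrite /H /H' !mulmxA mulmxK // -!mulmxA (mulmxA (invmx K)) mulVmx // mul1mx.
  by rewrite mulmxV.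
have -> : A *m invmx K *m B = ulsubmx H.
  by rewrite /H BhE /Ah mul_col_mx mul_col_row /ulsubmx col_mxKu row_mxKl.
rewrite (det_ulsubmx_mul HH').
pose U := dsubmx (invmx Bh); pose W := rsubmx (invmx Ah).
have -> : drsubmx H' = \matrix_(a, b) \sum_i
    (\sum_k U a k * u i k) * (\sum_k v i k * W k b).
  have Kij l k : K l k = \sum_i u i l * v i k by rewrite KE mxE.
  rewrite /H' -[invmx Bh]vsubmxK mul_col_mx mul_col_mx /drsubmx col_mxKd.
  rewrite -[invmx Ah]hsubmxK mul_mx_row row_mxKr -/U -/W.
  apply/matrixP=> a b; rewrite !mxE.
  under eq_bigr => k _.
    rewrite mxE; under eq_bigr => l _ do rewrite Kij mulr_sumr.
    rewrite exchange_big /= mulr_suml; over.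
  rewrite exchange_big /=; apply: eq_bigr => i _.
  rewrite big_distrr /=; apply: eq_bigr => k _.
  rewrite mulrA; congr (_ * _); rewrite mulr_suml.
  by apply: eq_bigr => l _; rewrite mulrA.
rewrite -mulrnAr -mulrnAr Cauchy_Binet !big_distrr /=; apply: eq_bigr => f _.
(* Multiplying by the inverse of [Bh] turns [B] into the first columns of the identity, so only the
   lower right block contributes; [detW] is the transposed argument. *)
have detU : \det (row_mx B (\matrix_(a, b) u (f b) a)) =
    \det Bh * \det (\matrix_(a, b) \sum_k U a k * u (f b) k).
  apply: (canRL (mulVKr _)); first by rewrite -unitmxE.
  rewrite -det_inv -det_mulmx mul_mx_row.
  have -> : invmx Bh *m B = col_mx 1%:M 0.
    have := mulVmx Bu; rewrite {2}BhE mul_mx_row => /(congr1 lsubmx).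
    by rewrite row_mxKl => ->; rewrite scalar_mx_block block_mxEh row_mxKl.
  rewrite -[invmx Bh *m (\matrix_(a, b) _)]vsubmxK -block_mxEh det_ublock det1 mul1r.
  congr (\det _); apply/matrixP=> a b; rewrite !mxE.
  by apply: eq_bigr => k _; rewrite !mxE.
have detW : \det (col_mx A (\matrix_(a, b) v (f a) b)) =
    \det Ah * \det (\matrix_(a, b) \sum_k v (f a) k * W k b).
  rewrite mulrC; apply: (canRL (mulrVK _)); first by rewrite -unitmxE.
  rewrite -det_inv -det_mulmx mul_col_mx.
  have -> : A *m invmx Ah = row_mx 1%:M 0.
    have := mulmxV Au; rewrite {1}/Ah mul_col_mx => /(congr1 usubmx).
    by rewrite col_mxKu => ->; rewrite scalar_mx_block /block_mx col_mxKu.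
  rewrite -[(\matrix_(a, b) _) *m invmx Ah]hsubmxK -/(block_mx _ _ _ _).
  rewrite det_lblock det1 mul1r.
  congr (\det _); apply/matrixP=> a b; rewrite !mxE.
  by apply: eq_bigr => k _; rewrite !mxE.
rewrite detU detW /H !det_mulmx det_inv.
have dK : \det K != 0 by rewrite -unitfE -unitmxE.
set x := \det Ah; set y := \det Bh; set k := \det K in dK *.
set du := \det _; set dw := \det _.
have -> : k * (x / k * y * (du * dw)) = k * k^-1 * (x * y * (du * dw)).
  by rewrite !mulrA; congr (_ * _ * _ * _); rewrite mulrAC.
by rewrite divff // mul1r [x * y]mulrC mulrACA.
Qed.

Lemma mem_01N1_mul (R : pzRingType) (x y : R) :
  x \in [:: 0; 1; -1] -> y \in [:: 0; 1; -1] -> x * y \in [:: 0; 1; -1].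
Proof.
rewrite !inE => /or3P[]/eqP-> /or3P[]/eqP->;
by rewrite !(mul0r, mulr0, mul1r, mulr1, mulrN1, opprK, oppr0) eqxx ?orbT.
Qed.

(* Expand along a column with at most one nonzero entry; if there is none, the
   rows sum to 0. *)
Lemma det_incidence_mem (R : idomainType) (n : nat) (M : 'M[R]_n)
    (h t : 'I_n -> option 'I_n) :
  (forall a j, M a j = (h j == Some a)%:R - (t j == Some a)%:R) ->
  \det M \in [:: 0; 1; -1].
Proof.
elim: n M h t => [|n IHn] M h t ME; first by rewrite det_mx00 !inE eqxx orbT.
have [j0 j0P|ht] := pickP (fun j => (h j == None) || (t j == None)); last first.
  suff /eqP-> : \det M == 0 by rewrite inE eqxx.
  apply/det0P; exists (const_mx 1).
    by apply/eqP=> /matrixP/(_ 0 0)/eqP; rewrite !mxE oner_eq0.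
  apply/matrixP=> i j; rewrite !mxE.
  have := ht j; case Eh: (h j) => [b|//]; case Et: (t j) => [d|//] _.
  under eq_bigr => a _ do rewrite mxE mul1r ME Eh Et.
  rewrite sumrB (bigD1 b) //= (bigD1 d (P := xpredT)) //= !eqxx !big1 ?addr0 ?subrr //.
    by move=> a /negPf; rewrite eq_sym [Some _ == _]/eq_op /= => ->.
  by move=> a /negPf; rewrite eq_sym [Some _ == _]/eq_op /= => ->.
(* Row of the only possibly nonzero entry of column [j0]; the default [ord0] is taken when that
   column is zero, where any row does. *)
pose a0 := odflt ord0 (if h j0 is Some a then Some a else t j0).
have Ma0 a : a != a0 -> M a j0 = 0.
  rewrite ME /a0 => {a0}; case/orP: j0P => /eqP->.
    by case: (t j0) => [d|] /=; rewrite ?subr0 // sub0r eq_sym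
      [Some _ == _]/eq_op /= => /negPf->; rewrite oppr0.
  by case: (h j0) => [d|] /=; rewrite ?subr0 // eq_sym
      [Some _ == _]/eq_op /= => /negPf->.
rewrite (expand_det_col M j0) (bigD1 a0) //= big1 ?addr0; last first.
  by move=> a /Ma0->; rewrite mul0r.
apply: mem_01N1_mul.
  by rewrite ME; case/orP: j0P => /eqP-> /=; case: eqP => _;
    rewrite ?subr0 ?sub0r ?oppr0 !inE eqxx ?orbT.
apply: mem_01N1_mul.
  by rewrite -signr_odd; case: odd; rewrite !inE eqxx ?orbT.
(* Deleting row [a0] grounds it: ends at [a0] become [None]. *)
apply: (IHn _ (fun j => obind (unlift a0) (h (lift j0 j)))
              (fun j => obind (unlift a0) (t (lift j0 j)))) => a j.
rewrite !mxE ME.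
have E x : (x == Some (lift a0 a)) = (obind (unlift a0) x == Some a).
  case: x => [x|] //=; case: unliftP => [b ->|->] /=.
    by rewrite [LHS]/eq_op /= (inj_eq lift_inj).
  by rewrite [LHS]/eq_op /= (negPf (neq_lift _ _)).
by rewrite !E.
Qed.

(** * Cycles and circulations in multigraphs *)

Lemma eq_set2 (T : finType) (a b x y : T) :
  [set a; b] = [set x; y] -> (a = x /\ b = y) \/ (a = y /\ b = x).
Proof.
move=> E; have: a \in [set x; y] by rewrite -E !inE eqxx.
have: b \in [set x; y] by rewrite -E !inE eqxx orbT.
have: x \in [set a; b] by rewrite E !inE eqxx.
have: y \in [set a; b] by rewrite E !inE eqxx orbT.
rewrite !inE => yab xab /orP[]/eqP bE /orP[]/eqP aE; subst; auto.
  by move: yab; rewrite orbb => /eqP->; left.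
by move: xab; rewrite orbb => /eqP->; left.
Qed.

Section MultigraphTheory.
Variables (W I : finType) (ends : I -> {set W}).
Implicit Types (S T : {set I}) (x y z : W).

Lemma mg_adj_sym S : symmetric (mg_adj ends S).
Proof. by move=> x y; apply: eq_existsb => i; rewrite setUC. Qed.

Lemma mg_connect_sym S x y :
  connect (mg_adj ends S) x y = connect (mg_adj ends S) y x.
Proof. exact: sym_connect_sym (mg_adj_sym S) x y. Qed.

Lemma mg_adj_ends S i x y : i \in S -> ends i = [set x; y] -> mg_adj ends S x y.
Proof. by move=> iS iE; apply/existsP; exists i; rewrite iS iE eqxx. Qed.

Lemma mg_connect_eq (A : eqType) S (f : W -> A) x y :
  (forall i a b, i \in S -> ends i = [set a; b] -> f a = f b) ->
  connect (mg_adj ends S) x y -> f x = f y.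
Proof.
move=> fE /connectP[p]; elim: p x => [x _ -> //|z p IHp x] /= /andP[xz zp] yE.
by rewrite -(IHp _ zp yE); case/existsP: xz => i /andP[iS /eqP/(fE _ _ _ iS)].
Qed.

Lemma mg_acyclicS S T : S \subset T -> mg_acyclic ends T -> mg_acyclic ends S.
Proof.
move=> sST /mg_acyclicP acT; apply/mg_acyclicP=> s; apply: contra (acT s).
case/and5P=> s0 u1 u2 sS sc; apply/and5P; split=> //.
by apply/allP=> i /(allP sS) iS; apply: (subsetP sST).
Qed.

(** Otherwise a simple path from [x] to [y] avoiding [i] would close up through [i] to a cycle. *)
Lemma mg_acyclic_bridge S i x y : mg_acyclic ends S -> i \in S ->
  ends i = [set x; y] -> ~~ connect (mg_adj ends (S :\ i)) x y.
Proof.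
move=> /mg_acyclicP acS iS iE; apply/negP=> /connectP[p0 p0P yE].
case/shortenP: p0P yE => {p0} p pP up _ yE.
pose e a b := odflt i [pick j in S :\ i | ends j == [set a; b]].
have eP a b : mg_adj ends (S :\ i) a b ->
    e a b \in S :\ i /\ ends (e a b) = [set a; b].
  move=> /existsP[j /andP[jS jE]]; rewrite /e; case: pickP => [k /andP[? /eqP]//|].
  by move/(_ j); rewrite jS jE.
pose w := pairmap (fun a b => (a, e a b)).
have w1 a r : unzip1 (w a r) = belast a r by elim: r a => //= b r IHr a; rewrite IHr.
have wE a r : path (mg_adj ends (S :\ i)) a r ->
    {in unzip2 (w a r), forall j, j \in S :\ i /\ ends j \subset a :: r}.
  elim: r a => //= b r IHr a /andP[/eP[eS eE] /IHr{}IHr] j; rewrite inE.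
  case/predU1P=> [->|/IHr[jS /subsetP jr]]; split=> //.
    by rewrite eE; apply/subsetP=> v; rewrite !inE => /orP[]->; rewrite ?orbT.
  by apply/subsetP=> v /jr vr; rewrite inE vr orbT.
(* The edge leaving [a] differs from all later ones, whose ends lie among the later vertices and so
   miss [a]. *)
have w2 a r : path (mg_adj ends (S :\ i)) a r -> uniq (a :: r) ->
    uniq (unzip2 (w a r)).
  elim: r a => //= b r IHr a /andP[/eP[eS eE] rP] /andP[ar ur].
  rewrite IHr // andbT; apply/negP=> /(wE _ _ rP)[_ /subsetP/(_ a)].
  by rewrite eE !inE eqxx => /(_ isT); rewrite -in_cons (negPf ar).
have wc a r z k : path (mg_adj ends (S :\ i)) a r -> last a r = y ->
    ends k = [set z; a] ->
    path (fun p p' => ends p.2 == [set p.1; p'.1]) (z, k) (rcons (w a r) (y, i)).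
  elim: r a z k => [|b r IHr] a z k /=; first by move=> _ <- ->; rewrite eqxx.
  by move=> /andP[/eP[_ eE] rP] yl ->; rewrite eqxx (IHr b a).
move/negP: (acS ((y, i) :: w x p)); apply; apply/and5P; split=> //=.
- by rewrite w1; move: up; rewrite -cons_uniq lastI -yE rcons_uniq.
- rewrite w2 // andbT; apply/negP=> /(wE _ _ pP)[].
  by rewrite !inE eqxx.
- by rewrite iS; apply/allP=> j /(wE _ _ pP)[]; rewrite inE => /andP[].
- by apply: wc => //; rewrite setUC.
Qed.

(** Any edge of a cycle will do: the remaining edges of the cycle join its two ends. *)
Lemma mg_cycle_chord S : ~~ mg_acyclic ends S ->
  exists i x y, [/\ i \in S, ends i = [set x; y] &
    connect (mg_adj ends (S :\ i)) x y].
Proof.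
move=> acS; have [s] : exists s, mg_cycle ends S s.
  move: acS; rewrite negb_forall => /existsP[n]; rewrite negb_forall => /existsP[t].
  by rewrite negbK => ?; exists t.
case: s => [//|[x i] s] /and5P[_ _ /= /andP[is_ us] /andP[iS sS] sc].
have sT : all (mem (S :\ i)) (unzip2 s).
  apply/allP=> j js; have jS := allP sS _ js; rewrite !inE [j \in S]jS andbT.
  by apply: contraNneq is_ => <-.
(* The induction along the cycle needs a free starting pair [(z, k)]: the far end [y] of [k] reaches
   [x] through the later edges. *)
have chain T z k : all (mem T) (unzip2 s) ->
    path (fun p p' => ends p.2 == [set p.1; p'.1]) (z, k) (rcons s (x, i)) ->
    exists y, ends k = [set z; y] /\ connect (mg_adj ends T) y x.
  elim: s z k {is_ us sS sc sT} => [|[a j] s IHs] z k /=.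
    by move=> _ /andP[/eqP kE _]; exists x; rewrite connect0.
  move=> /andP[jT sT] /andP[/eqP kE /(IHs _ _ sT)[y [jE yx]]]; exists a; split=> //.
  by apply: connect_trans yx; apply: connect1; apply: mg_adj_ends jE.
have [y [iE yx]] := chain _ _ _ sT sc.
by exists i, x, y; rewrite mg_connect_sym.
Qed.

Variables (R : pzRingType) (t h : I -> W).

(* Boundaries of 1-chains are handled through their pairing with an arbitrary
   potential [y], which spares choosing a ground vertex. *)
Lemma connect_flow S a b :
  (forall i, i \in S -> ends i = [set t i; h i]) ->
  connect (mg_adj ends S) a b ->
  exists x : I -> R, (forall i, i \notin S -> x i = 0) /\
    forall y : W -> R, \sum_i x i * (y (h i) - y (t i)) = y b - y a.
Proof.
move=> arcE /connectP[p]; elim: p a => [|c p IHp] a /=.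
  move=> _ ->; exists (fun=> 0); split=> // y.
  by rewrite subrr big1 // => i _; rewrite mul0r.
case/andP=> /existsP[j /andP[jS /eqP jE]] cp /(IHp _ cp){IHp cp}[x [xS xE]].
(* The sign is 1 or -1 according to whether the walk follows edge [j] along or against its
   orientation. *)
have [s sE] : exists s : R, forall y : W -> R, s * (y (h j) - y (t j)) = y c - y a.
  move: jE; rewrite arcE // => /eq_set2[[-> ->]|[-> ->]].
    by exists 1 => y; rewrite mul1r.
  by exists (-1) => y; rewrite mulN1r opprB.
exists (fun i => (if i == j then s else 0) + x i); split=> [i iS|y].
  by rewrite xS // addr0; case: eqP => // ij; rewrite ij jS in iS.
under eq_bigr => i _ do rewrite mulrDl.
rewrite big_split /= xE (bigD1 j) //= eqxx sE big1 ?addr0; last first.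
  by move=> i /negPf->; rewrite mul0r.
by rewrite addrC addrA subrK.
Qed.

(** Edge [i] is a bridge, so it alone crosses the cut around the component of [t i] left after its
    deletion. Pairing the circulation with the indicator of that component gives [x i = 0]. *)
Lemma acyclic_circulation_eq0 S (x : I -> R) :
  (forall i, i \in S -> ends i = [set t i; h i]) -> mg_acyclic ends S ->
  (forall i, i \notin S -> x i = 0) ->
  (forall y : W -> R, \sum_i x i * (y (h i) - y (t i)) = 0) ->
  forall i, x i = 0.
Proof.
move=> arcE acS xS x0 i; have [iS|/xS//] := boolP (i \in S).
have tNh := mg_acyclic_bridge acS iS (arcE i iS).
have := x0 (fun v => (connect (mg_adj ends (S :\ i)) (t i) v)%:R).
rewrite (bigD1 i) //= (negPf tNh) connect0 sub0r mulrN1 big1 => [|j ji].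
  by rewrite addr0 => /eqP; rewrite oppr_eq0 => /eqP.
have [jS|/xS->] := boolP (j \in S); last by rewrite mul0r.
suff -> : connect (mg_adj ends (S :\ i)) (t i) (h j) =
          connect (mg_adj ends (S :\ i)) (t i) (t j) by rewrite subrr mulr0.
have tj : mg_adj ends (S :\ i) (t j) (h j).
  by apply: mg_adj_ends (arcE j jS); rewrite !inE ji.
apply/idP/idP=> /connect_trans; apply; last exact: connect1.
by rewrite connect1 // mg_adj_sym.
Qed.

(** The circulation is a flow from [t i] to [h i] through the rest of a cycle, minus one unit on its
    edge [i]. *)
Lemma cyclic_circulation S :
  (forall i, i \in S -> ends i = [set t i; h i]) ->
  (1 : R) != 0 -> ~~ mg_acyclic ends S ->
  exists x : I -> R, [/\ exists i, x i != 0, forall i, i \notin S -> x i = 0 &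
    forall y : W -> R, \sum_i x i * (y (h i) - y (t i)) = 0].
Proof.
move=> arcE R1 /mg_cycle_chord[i [a [b [iS iE ab]]]].
have {a b iE ab} : connect (mg_adj ends (S :\ i)) (t i) (h i).
  by move: iE; rewrite arcE // => /eq_set2[[-> ->]|[-> ->]] //; rewrite mg_connect_sym.
have arcE' j : j \in S :\ i -> ends j = [set t j; h j].
  by case/setD1P=> _ /arcE.
move=> /(connect_flow arcE')[x [xS xE]].
exists (fun j => x j - (j == i)%:R); split.
- by exists i; rewrite eqxx xS ?sub0r ?oppr_eq0 // !inE eqxx.
- move=> j jS; rewrite xS ?inE ?negb_and ?jS ?orbT // sub0r.
  by case: eqP => [ji|]; rewrite ?oppr0 //; rewrite ji iS in jS.
move=> y; under eq_bigr => j _ do rewrite mulrBl.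
rewrite sumrB xE (bigD1 i) //= eqxx mul1r big1 ?addr0 ?subrr // => j /negPf->.
by rewrite mul0r.
Qed.

End MultigraphTheory.

(** * Incidence matrices and potentials *)

Section Incidence.
Variables (R : realFieldType) (V : finType) (g : V).
Implicit Types (y : 'rV[R]_#|[set~ g]|).

(* The potential vanishing at [g] encoded by a row vector. *)
Definition potential y (v : V) : R := (y *m std_vec R g v) 0 0.

Lemma potential_ground y : potential y g = 0.
Proof.
rewrite /potential mxE big1 // => a _; rewrite mxE.
by have := enum_valP a; rewrite !inE => /negPf->; rewrite mulr0.
Qed.

Lemma potential_enum_val y a : potential y (enum_val a) = y 0 a.
Proof.
rewrite /potential mxE (bigD1 a) //= mxE eqxx mulr1 big1 ?addr0 // => b ba.
by rewrite mxE (inj_eq enum_val_inj) (negPf ba) mulr0.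
Qed.

Lemma potential_inj y y' : potential y =1 potential y' -> y = y'.
Proof.
move=> E; apply/matrixP=> i a; rewrite ord1.
by rewrite -!potential_enum_val.
Qed.

Lemma potential0 v : potential 0 v = 0.
Proof. by rewrite /potential mul0mx mxE. Qed.

Lemma ground_cases (v : V) : v = g \/ exists a : 'I_#|[set~ g]|, v = enum_val a.
Proof.
have [->|vg] := eqVneq v g; [by left | right].
have vS : v \in [set~ g] by rewrite !inE.
by exists (enum_rank_in vS v); rewrite enum_rankK_in.
Qed.

Lemma potentialE (Y : V -> R) : Y g = 0 ->
  potential (\row_a Y (enum_val a)) =1 Y.
Proof.
move=> Yg v; case: (ground_cases v) => [->|[a ->]].
  by rewrite potential_ground Yg.
by rewrite potential_enum_val mxE.
Qed.

Lemma mul_incidence y p (a : 'I_p -> V * V) i j :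
  (y *m incidence a R g) i j = potential y (a j).2 - potential y (a j).1.
Proof.
rewrite /potential ord1 !mxE -sumrB; apply: eq_bigr => b _.
by rewrite !mxE mulrBr.
Qed.

(** Grounding loses nothing: subtracting [Y g] from a potential does not change its differences.
    Conversely, the indicators of the nonground vertices recover the rows. *)
Lemma incidence_mul_eq0 p (a : 'I_p -> V * V) (x : 'cV[R]_p) :
  incidence a R g *m x = 0 <->
  forall Y : V -> R, \sum_j x j 0 * (Y (a j).2 - Y (a j).1) = 0.
Proof.
split=> [ax0 Y|x0].
  have Y'E := @potentialE (fun v => Y v - Y g) (subrr _).
  set y := \row_a _ in Y'E.
  have /matrixP/(_ 0 0) : y *m incidence a R g *m x = 0.
    by rewrite -mulmxA ax0 mulmx0.
  rewrite !mxE => E; rewrite -[RHS]E; apply: eq_bigr => j _.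
  by rewrite mul_incidence !Y'E mulrC; congr (_ * _); rewrite opprB addrA subrK.
apply/matrixP=> b i; rewrite ord1 [RHS]mxE mxE.
rewrite -[RHS](x0 (fun v => (enum_val b == v)%:R)).
by apply: eq_bigr => j _; rewrite !mxE mulrC.
Qed.

(** Linear relations among the columns are circulations supported on the selected edges; nonzero
    ones exist exactly when there is a cycle. *)
Lemma incidence_free (I : finType) (ends : I -> {set V}) (arc : I -> V * V) p
    (phi : 'I_p -> I) : injective phi ->
  (forall j, ends (phi j) = [set (arc (phi j)).1; (arc (phi j)).2]) ->
  row_free (incidence (arc \o phi) R g)^T = mg_acyclic ends [set phi j | j : 'I_p].
Proof.
move=> phi_inj arcE; set S := [set _ | _ : _].
have arcS i : i \in S -> ends i = [set (arc i).1; (arc i).2].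
  by case/imsetP=> j _ ->.
apply/idP/idP=> [fr|acS].
  apply: contraT => /(cyclic_circulation arcS (oner_neq0 R))[x [[i xi0] xS x0]].
  have /incidence_mul_eq0 : forall Y : V -> R, \sum_j (\col_j x (phi j)) j 0 *
      (Y ((arc \o phi) j).2 - Y ((arc \o phi) j).1) = 0.
    move=> Y; rewrite -[RHS](x0 Y) (bigID (mem S)) /= [X in _ + X]big1 ?addr0.
      rewrite big_imset /=; last by move=> ? ? _ _ /phi_inj.
      by apply: eq_bigr => j _; rewrite mxE.
    by move=> j /xS->; rewrite mul0r.
  move/(congr1 trmx); rewrite trmx_mul trmx0 => /eqP.
  rewrite mulmx_free_eq0 // => /eqP/matrixP xE.
  have /imsetP[j _ ij] : i \in S by apply: contraNT xi0 => /xS->.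
  by move: xi0; have := xE 0 j; rewrite !mxE ij => ->; rewrite eqxx.
(* [x'] extends the coefficients by zero to all edge names; injectivity of [phi] leaves at most one
   term in each sum. *)
apply: inj_row_free => x xa; pose x' i := \sum_(j | phi j == i) x 0 j.
have x'E j : x' (phi j) = x 0 j.
  rewrite /x' (bigD1 j) //= big1 ?addr0 // => k /andP[/eqP/phi_inj->].
  by rewrite eqxx.
apply/matrixP=> i j; rewrite ord1 mxE -x'E.
apply: (acyclic_circulation_eq0 arcS acS) => [k kS|Y].
  by rewrite /x' big_pred0 // => l; apply: contraNF kS => /eqP<-; apply: imset_f.
have /incidence_mul_eq0/(_ Y) : incidence (arc \o phi) R g *m x^T = 0.
  by rewrite -[LHS]trmxK trmx_mul trmxK xa trmx0.
move=> x0; rewrite -[RHS]x0 /x'.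
under eq_bigr => k _ do rewrite mulr_suml big_mkcond /=.
rewrite exchange_big /=; apply: eq_bigr => l _.
by rewrite -big_mkcond (big_pred1 (phi l)) ?mxE // => k; apply: eq_sym.
Qed.

End Incidence.

Lemma eq_pick_Some (T : finType) (P : pred T) (x : T) :
  {in P &, forall y z, y = z} -> ([pick y | P y] == Some x) = P x.
Proof.
move=> P1; case: pickP => [y Py|->] //=.
apply/eqP/idP=> [[<-]//|Px]; congr Some; exact: P1.
Qed.

Lemma det_incidence (R : realFieldType) (V : finType) (g : V)
    (a : 'I_#|[set~ g]| -> V * V) :
  \det (incidence a R g) \in [:: 0; 1; -1].
Proof.
(* The ground is sent to [None], the missing end allowed by [det_incidence_mem]. *)
pose num v := [pick b : 'I_#|[set~ g]| | enum_val b == v].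
apply: (@det_incidence_mem _ _ _ (fun j => num (a j).2) (fun j => num (a j).1)).
move=> b j; rewrite !mxE !eq_pick_Some // => c d;
by move=> /eqP<- /eqP/enum_val_inj.
Qed.

(** In the basis formed by the columns of [D0] and [X], the matrix [Q] reads off the first [r]
    coordinates. There [[D | X]] becomes block lower triangular, with diagonal blocks [Q *m D] and
    the identity. *)
Lemma det_bordered (R : fieldType) (n r p : nat) (hn : (r + p)%N = n)
    (Q : 'M[R]_(r, n)) (D0 D : 'M[R]_(n, r)) (X : 'M[R]_(n, p)) :
  Q *m D0 = 1%:M -> Q *m X = 0 ->
  castmx (erefl n, hn) (row_mx D0 X) \in unitmx ->
  \det (castmx (erefl n, hn) (row_mx D X)) =
  \det (castmx (erefl n, hn) (row_mx D0 X)) * \det (Q *m D).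
Proof.
case: n / hn Q D0 D X => Q D0 D X QD0 QX; rewrite !castmx_id => M0u.
set M0 := row_mx D0 X in M0u *.
have M0X : invmx M0 *m X = col_mx 0 1%:M.
  have := mulVmx M0u; rewrite {2}/M0 mul_mx_row => /(congr1 rsubmx).
  by rewrite row_mxKr scalar_mx_block block_mxEh row_mxKr => ->.
have QD : Q *m D = usubmx (invmx M0 *m D).
  have QM0 : Q *m M0 = row_mx 1%:M 0 by rewrite mul_mx_row QD0 QX.
  rewrite -[in LHS](mulKVmx M0u D) (mulmxA Q) QM0.
  by rewrite -{1}[invmx M0 *m D]vsubmxK mul_row_col mul1mx mul0mx addr0.
rewrite -{1}(mulKVmx M0u (row_mx D X)) det_mulmx mul_mx_row M0X.
by rewrite -[invmx M0 *m D]vsubmxK -block_mxEh det_lblock det1 mulr1 QD.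
Qed.

(** * Components and quotient incidence matrices *)

Section Components.
Variables (R : realFieldType) (V : finType) (g : V) (F : {set {set V}}).

Lemma component_eq u v :
  (component F u == component F v) = connect (mg_adj id F) u v.
Proof.
apply/eqP/idP=> [/setP/(_ v)|uv]; first by rewrite !inE connect0.
apply/setP=> w; rewrite !inE; apply/idP/idP; apply: connect_trans => //.
by rewrite mg_connect_sym.
Qed.

Lemma component_in v : component F v \in components F.
Proof. exact: imset_f. Qed.

Variables (s : seq {set V}) (r : nat).
Hypotheses (sP : component_order g F s) (r1 : #|components F| = r.+1).

Let size_s : size s = r.+1.
Proof. by case/andP: sP => /perm_size-> _; rewrite -cardE. Qed.

Let mem_s X : (X \in s) = (X \in components F).
Proof. by case/andP: sP => /perm_mem-> _; rewrite mem_enum. Qed.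

Let uniq_s : uniq s.
Proof. by case/andP: sP => /perm_uniq-> _; rewrite enum_uniq. Qed.

Let nth_s (i : 'I_r.+1) : nth set0 s i \in components F.
Proof. by rewrite -mem_s mem_nth // size_s. Qed.

Lemma nth_component_mem (a : 'I_r) : nth set0 s a.+1 \in components F.
Proof. by rewrite -mem_s mem_nth // size_s ltnS. Qed.

Lemma nth_component_inj (a b : 'I_r) : nth set0 s a.+1 = nth set0 s b.+1 -> a = b.
Proof.
move/eqP; rewrite nth_uniq ?size_s ?ltnS // eqSS => /eqP; exact: val_inj.
Qed.

Let mem_component X v : X \in components F -> (v \in X) = (component F v == X).
Proof. by case/imsetP=> u _ ->; rewrite inE component_eq mg_connect_sym. Qed.

Let nth_s0 : nth set0 s 0 = component F g.
Proof.
by have /andP[_] := sP; rewrite (mem_component _ (nth_s ord0)) => /eqP.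
Qed.

Lemma components_cases X : X \in components F ->
  X = component F g \/ exists a : 'I_r, X = nth set0 s a.+1.
Proof.
rewrite -mem_s => Xs; have := nth_index set0 Xs; move: Xs; rewrite -index_mem size_s.
case: index => [_ <-|a ar <-]; [by left; rewrite nth_s0 | right].
by exists (Ordinal (ar : (a < r)%N)).
Qed.

Lemma ground_component_neq (a : 'I_r) : (component F g == nth set0 s a.+1) = false.
Proof. by rewrite -nth_s0 nth_uniq ?size_s ?ltnS. Qed.

Local Notation Q := (quotient_mx R g r s).

Lemma potential_quotient (y : 'rV[R]_r) v :
  potential (y *m Q) v =
  \sum_a y 0 a * (component F v == nth set0 s a.+1)%:R.
Proof.
pose Y v := \sum_a y 0 a * (component F v == nth set0 s (a : 'I_r).+1)%:R.
rewrite -[RHS]/(Y v) -(@potentialE _ _ g Y); last first.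
  by rewrite /Y big1 // => a _; rewrite ground_component_neq mulr0.
congr (potential _ v); apply/matrixP=> i b; rewrite ord1 !mxE.
by apply: eq_bigr => a _; rewrite mxE mem_component ?nth_component_mem.
Qed.

(** The product is the incidence matrix of the quotient multigraph, grounded at the component of
    [g]; a loop gives a zero column. *)
Lemma quotient_mul_incidence p (P : 'I_p -> V * V) a j :
  (Q *m incidence P R g) a j = (component F (P j).2 == nth set0 s a.+1)%:R -
                               (component F (P j).1 == nth set0 s a.+1)%:R.
Proof.
have E v : potential (row a Q) v = (component F v == nth set0 s a.+1)%:R.
  rewrite rowE potential_quotient (bigD1 a) //= mxE !eqxx mul1r big1 ?addr0 //.
  by move=> b ba; rewrite mxE (negPf ba) andbF mul0r.
by rewrite -!E -(mul_incidence _ _ 0) -row_mul [RHS]mxE.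
Qed.

Lemma det_quotient_incidence (P : 'I_r -> V * V) :
  \det (Q *m incidence P R g) \in [:: 0; 1; -1].
Proof.
pose num v := [pick a : 'I_r | component F v == nth set0 s a.+1].
apply: (@det_incidence_mem _ _ _ (fun j => num (P j).2) (fun j => num (P j).1)).
move=> b j; rewrite quotient_mul_incidence !eq_pick_Some // => c d;
by move=> /eqP-> /eqP/nth_component_inj.
Qed.

Lemma sum_quotient (f : {set V} -> R) X : f (component F g) = 0 ->
  X \in components F ->
  \sum_a f (nth set0 s (a : 'I_r).+1) * (X == nth set0 s a.+1)%:R = f X.
Proof.
move=> fg /components_cases[->|[a ->]].
  by rewrite fg big1 // => a _; rewrite ground_component_neq mulr0.
rewrite (bigD1 a) //= eqxx mulr1 big1 ?addr0 // => b ba.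
by case: eqP => [/nth_component_inj ab|]; rewrite ?mulr0 //; rewrite ab eqxx in ba.
Qed.

(** Invertibility excludes left null vectors, which forces connectivity, and right null vectors,
    which forces acyclicity since a cycle carries a circulation. Conversely, a left null vector is a
    potential constant along the edges of a connected graph and zero at the ground. *)
Lemma quotient_spanning_treeE q (P : 'I_q -> V * V) (phi : 'I_r -> 'I_q) :
  injective phi ->
  (\det (Q *m incidence (P \o phi) R g) != 0) =
  quotient_spanning_tree P F [set phi j | j : 'I_r].
Proof.
move=> phi_inj; set A := [set _ | _ : _]; set M := Q *m _.
set ends := quotient_ends P F.
have arcE i : ends i = [set (quotient_arc P F i).1; (quotient_arc P F i).2] by [].
apply/idP/andP=> [Mn0|[conn _]].
  have Mu : M \in unitmx by rewrite unitmxE unitfE.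
  split.
    suff connA X : X \in components F -> connect (mg_adj ends A) (component F g) X.
      apply/forallP=> X; apply/implyP=> XF; apply/forallP=> Y; apply/implyP=> YF.
      by apply: connect_trans (connA Y YF); rewrite mg_connect_sym connA.
    (* [f] marks the components not reachable from the ground; it is constant along the selected
       edges, hence gives a left null vector of [M]. *)
    pose f X : R := (~~ connect (mg_adj ends A) (component F g) X)%:R.
    have fg : f (component F g) = 0 by rewrite /f connect0.
    suff f0 : \row_a f (nth set0 s (a : 'I_r).+1) = 0.
      case/components_cases=> [->|[a ->]]; first exact: connect0.
      have /matrixP/(_ 0 a)/eqP := f0; rewrite !mxE /f pnatr_eq0 eqb0 negbK.
      by [].
    apply: (can_inj (mulmxK Mu)); rewrite mul0mx.
    apply/matrixP=> i j; rewrite ord1 !mxE.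
    under eq_bigr => a _ do rewrite mxE quotient_mul_incidence mulrBr.
    rewrite sumrB !sum_quotient ?component_in //=; apply/eqP.
    rewrite subr_eq0 /f; apply/eqP.
    congr (~~ _)%:R.
    have adj : mg_adj ends A (component F (P (phi j)).1) (component F (P (phi j)).2).
      exact: mg_adj_ends (imset_f _ _) (arcE (phi j)).
    apply/idP/idP=> /connect_trans; apply; last exact: connect1.
    by rewrite connect1 // mg_adj_sym.
  apply: contraT => /(cyclic_circulation (fun i _ => arcE i) (oner_neq0 R)).
  case=> x [[i xi0] xS x0].
  suff /matrixP xE : \col_j x (phi j) = 0.
    have /imsetP[j _ ij] : i \in A by apply: contraNT xi0 => /xS->.
    by move: xi0; have := xE j 0; rewrite !mxE ij => ->; rewrite eqxx.
  apply: (can_inj (mulKmx Mu)); rewrite mulmx0.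
  apply/matrixP=> a k; rewrite ord1 mxE [RHS]mxE.
  rewrite -[RHS](x0 (fun X => (X == nth set0 s a.+1)%:R)).
  rewrite (bigID (mem A)) /= [X in _ = _ + X]big1 ?addr0; last first.
    by move=> j /xS->; rewrite mul0r.
  rewrite big_imset /=; last by move=> ? ? _ _ /phi_inj.
  by apply: eq_bigr => j _; rewrite quotient_mul_incidence mxE mulrC.
apply/negP=> /det0P[y /negP yn0 /matrixP yM]; apply: yn0.
pose f X : R := \sum_a y 0 a * (X == nth set0 s a.+1)%:R.
have fE : f (component F g) = 0.
  by rewrite /f big1 // => a _; rewrite ground_component_neq mulr0.
apply/eqP/matrixP=> i a; rewrite ord1 mxE.
have <- : f (nth set0 s a.+1) = y 0 a.
  rewrite /f (bigD1 a) //= eqxx mulr1 big1 ?addr0 // => b ba.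
  by case: eqP => [/nth_component_inj ab|]; rewrite ?mulr0 //; rewrite ab eqxx in ba.
rewrite -fE; apply: (@mg_connect_eq _ _ ends _ A) => [k X Y /imsetP[j _ ->] kE|].
  have fj : f (component F (P (phi j)).2) = f (component F (P (phi j)).1).
    apply/eqP; rewrite -subr_eq0 /f -sumrB; apply/eqP.
    have := yM 0 j; rewrite !mxE => yj0; rewrite -[RHS]yj0; apply: eq_bigr => b _.
    by rewrite quotient_mul_incidence mulrBr.
  by move: kE; rewrite arcE => /eq_set2[[<- <-]|[<- <-]].
move/forallP/(_ (nth set0 s a.+1)): conn; rewrite nth_component_mem.
by move=> /forallP/(_ (component F g)); rewrite component_in.
Qed.

End Components.

(** * Bordered incidence determinants of spanning forests *)

Lemma castmx_row_incidence (R : realFieldType) (V : finType) (g : V) (r p : nat)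
    (a : 'I_r -> V * V) (b : 'I_p -> V * V) (hn : (r + p)%N = #|[set~ g]|) :
  castmx (erefl _, hn) (row_mx (incidence a R g) (incidence b R g)) =
  incidence (fun j => match split (cast_ord (esym hn) j) with
                      | inl i => a i | inr i => b i end) R g.
Proof.
apply/matrixP=> i j; rewrite castmxE !mxE cast_ord_id.
by case: split => k; rewrite !mxE.
Qed.

Lemma castmx_unitE (R : fieldType) (n m : nat) (hn : m = n) (M : 'M[R]_(n, m)) :
  (castmx (erefl n, hn) M \in unitmx) = row_free M.
Proof. by case: n / hn M => M; rewrite castmx_id row_free_unit. Qed.

Section Forest.
Variables (R : realFieldType) (V : finType) (g : V) (F : {set {set V}}).
Variables (s : seq {set V}) (r : nat).
Hypotheses (sP : component_order g F s) (r1 : #|components F| = r.+1).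
Variables (arc : {set V} -> V * V) (p : nat) (phi : 'I_p -> {set V}).
Hypotheses (phi_inj : injective phi) (FE : F = [set phi j | j : 'I_p]).
Hypothesis arcE : forall j, phi j = [set (arc (phi j)).1; (arc (phi j)).2].

Local Notation Q := (quotient_mx R g r s).
Local Notation X := (incidence (arc \o phi) R g).

Lemma connect_forest j : connect (mg_adj id F) (arc (phi j)).1 (arc (phi j)).2.
Proof. by apply: connect1; apply: mg_adj_ends (arcE j); rewrite FE imset_f. Qed.

Lemma quotient_mul_forest : Q *m X = 0.
Proof.
apply/matrixP=> a j; rewrite (quotient_mul_incidence _ sP r1) mxE /=.
suff /eqP-> : component F (arc (phi j)).1 == component F (arc (phi j)).2.
  by rewrite subrr.
by rewrite component_eq connect_forest.
Qed.

(** The default [g] is never reached, since components are nonempty. *)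
Definition representative (a : 'I_r) : V :=
  odflt g [pick v | component F v == nth set0 s a.+1].

Lemma component_representative a :
  component F (representative a) = nth set0 s a.+1.
Proof.
rewrite /representative; case: pickP => [v /eqP//|noV].
have /imsetP[v _ vE] := nth_component_mem sP r1 a.
by have := noV v; rewrite -vE eqxx.
Qed.

Local Notation D0 := (incidence (fun a => (g, representative a)) R g).

Lemma quotient_mul_representative : Q *m D0 = 1%:M.
Proof.
apply/matrixP=> a b; rewrite (quotient_mul_incidence _ sP r1) mxE /=.
rewrite (ground_component_neq sP r1) subr0 component_representative.
by congr (nat_of_bool _)%:R; apply/eqP/eqP=> [/(nth_component_inj sP r1)|->].
Qed.

(** A potential killed by [X] is constant on components, and one killed by [D0] takes its ground
    value 0 at every representative. *)
Lemma row_free_forest : row_free (row_mx D0 X).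
Proof.
apply: inj_row_free => y; rewrite mul_mx_row -[0]hsubmxK => /eq_row_mx[].
rewrite !linear0 => yD0 yX; apply: (@potential_inj _ _ g) => v.
have yF u w : connect (mg_adj id F) u w -> potential y u = potential y w.
  apply: mg_connect_eq => f a b; rewrite FE => /imsetP[j _ ->].
  have /eqP : (y *m X) 0 j = 0 by rewrite yX mxE.
  rewrite mul_incidence subr_eq0 => /eqP /= fj.
  by rewrite arcE => /eq_set2[[<- <-]|[<- <-]].
rewrite potential0.
have [/eqP|[a /eqP]] := components_cases sP r1 (component_in F v).
  by rewrite component_eq => /yF->; rewrite potential_ground.
rewrite -component_representative component_eq => /yF->.
have := mul_incidence y (fun a => (g, representative a)) 0 a.
by rewrite yD0 mxE potential_ground subr0.
Qed.

(** The rank of [X] is the number of nonground vertices minus [r]: at least this because [[D0 | X]]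
    has full row rank, at most this because [Q] has rank [r] and kills [X]. Acyclicity says that
    this rank is [p]. *)
Lemma acyclic_forestE : mg_acyclic id F = ((r + p)%N == #|[set~ g]|).
Proof.
rewrite FE -(@incidence_free R _ g _ id arc) // /row_free mxrank_tr.
have QX := mulmx0_rank_max quotient_mul_forest.
have rQ : \rank Q = r.
  apply/eqP; rewrite -[_ == r]/(row_free Q); apply/row_freeP.
  by exists D0; apply: quotient_mul_representative.
have MX : (#|[set~ g]| <= r + \rank X)%N.
  have /eqP {1}<- := row_free_forest; rewrite -[X in (X <= _)%N]mxrank_tr tr_row_mx.
  rewrite -addsmxE; apply: leq_trans (mxrank_adds_leqif _ _) _.
  by rewrite !mxrank_tr leq_add2r rank_leq_col.
have nE : (r + \rank X)%N = #|[set~ g]|.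
  by apply/eqP; rewrite eqn_leq MX andbT -{1}rQ.
by rewrite -[RHS](congr1 (fun m => (r + p == m)%N) nE) eqn_add2l eq_sym.
Qed.

(** The factor [e] is the determinant of [[D0 | X]], an invertible incidence matrix, hence a sign.
    It does not depend on [P], so it cancels between two families of dipoles. *)
Lemma det_row_forest (hn : (r + p)%N = #|[set~ g]|) :
  exists2 e : R, e * e = 1 & forall P : 'I_r -> V * V,
    \det (castmx (erefl _, hn) (row_mx (incidence P R g) X)) =
    e * \det (Q *m incidence P R g).
Proof.
set M0 := castmx (erefl _, hn) (row_mx D0 X).
have M0u : M0 \in unitmx.
  by rewrite castmx_unitE row_free_forest.
exists (\det M0) => [|P]; last first.
  exact: (det_bordered _ quotient_mul_representative quotient_mul_forest M0u).
have : \det M0 \in [:: 0; 1; -1] by rewrite /M0 castmx_row_incidence det_incidence.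
move: M0u; rewrite unitmxE unitfE !inE => /negPf-> /=.
by case/orP=> /eqP->; rewrite ?mul1r ?mulrNN ?mul1r.
Qed.

End Forest.

(** * Complementary minors of the inverse *)

Section Selection.
Variables (q r : nat) (A : {set 'I_q}) (hA : #|A| = r).

Lemma sel_inj : injective (sel hA).
Proof. by move=> i j /enum_val_inj /cast_ord_inj. Qed.

Lemma sel_in i : sel hA i \in A.
Proof. exact: enum_valP. Qed.

Lemma imset_sel : [set sel hA i | i : 'I_r] = A.
Proof.
apply/eqP; rewrite eqEcard card_imset; last exact: sel_inj.
rewrite card_ord hA leqnn andbT.
by apply/subsetP=> _ /imsetP[i _ ->]; apply: sel_in.
Qed.

Lemma mul_basis_mx (R : realFieldType) m (M : 'M[R]_(m, q)) :
  M *m basis_mx R hA = colsub (sel hA) M.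
Proof.
apply/matrixP=> i j; rewrite !mxE (bigD1 (sel hA j)) //= mxE eqxx mulr1.
by rewrite big1 ?addr0 // => k kj; rewrite mxE (negPf kj) mulr0.
Qed.

Lemma tr_basis_mul_mx (R : realFieldType) m (M : 'M[R]_(q, m)) :
  (basis_mx R hA)^T *m M = rowsub (sel hA) M.
Proof.
by apply: trmx_inj; rewrite trmx_mul trmxK mul_basis_mx trmx_mxsub.
Qed.

End Selection.

Lemma tr_basis_mx_mul (R : realFieldType) (q r : nat) (A : {set 'I_q})
    (hA : #|A| = r) : (basis_mx R hA)^T *m basis_mx R hA = 1%:M.
Proof.
rewrite tr_basis_mul_mx; apply/matrixP=> i j.
by rewrite !mxE (inj_eq (@sel_inj _ _ _ hA)).
Qed.

Lemma tr_basis_mx_mul0 (R : realFieldType) (q r k : nat) (A I : {set 'I_q})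
    (hA : #|A| = r) (hI : #|I| = k) :
  [disjoint A & I] -> (basis_mx R hA)^T *m basis_mx R hI = 0.
Proof.
move=> dAI; rewrite tr_basis_mul_mx; apply/matrixP=> i j; rewrite !mxE.
case: eqP => // eij; have := disjointFr dAI (sel_in hA i).
by rewrite eij sel_in.
Qed.

Lemma tr_row_basis_mul (R : realFieldType) (q r k : nat) (I : {set 'I_q})
    (hA : #|~: I| = r) (hI : #|I| = k) :
  let B := row_mx (basis_mx R hA) (basis_mx R hI) in B^T *m B = 1%:M.
Proof.
rewrite /= tr_row_mx mul_col_row !tr_basis_mx_mul !tr_basis_mx_mul0 -?scalar_mx_block //.
  by rewrite disjoint_sym disjoints_subset.
by rewrite disjoints_subset.
Qed.

Section Completion.
Variables (R : realFieldType) (q r k : nat) (hrk : (r + k)%N = q).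

(** The permutation matrix listing [~: I] before [I]; its determinant is the sign of this
    shuffle. *)
Definition basis_completion (I : {set 'I_q}) (hA : #|~: I| = r) (hI : #|I| = k) :
    'M[R]_q :=
  castmx (erefl q, hrk) (row_mx (basis_mx R hA) (basis_mx R hI)).

Local Notation ehat hA hI := (\det (basis_completion hA hI)).

Lemma sqr_det_basis_completion I (hA : #|~: I| = r) (hI : #|I| = k) :
  ehat hA hI * ehat hA hI = 1.
Proof.
rewrite /basis_completion -{1}det_tr -det_mulmx; case: q / hrk I hA hI => I hA hI.
by rewrite castmx_id tr_row_basis_mul det1.
Qed.

(** Multiplying on the right by the shuffle matrix makes the completed matrix block upper
    triangular, with the identity as lower right block. *)
Lemma det_completion I (hA : #|~: I| = r) (hI : #|I| = k) (M : 'M[R]_(r, q)) :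
  \det (castmx (hrk, erefl q) (col_mx M (basis_mx R hI)^T)) =
  ehat hA hI * \det (colsub (sel hA) M).
Proof.
rewrite -[LHS]mul1r -(sqr_det_basis_completion hA hI) -mulrA; congr (_ * _).
rewrite /basis_completion mulrC -det_mulmx.
case: q / hrk I hA hI M => I hA hI M; rewrite !castmx_id mul_col_row.
rewrite mul_basis_mx tr_basis_mx_mul tr_basis_mx_mul0 ?det_ublock ?det1 ?mulr1 //.
by rewrite disjoint_sym disjoints_subset.
Qed.

(** Shuffling the rows of [Z] by [J] and its columns by [I] brings the two complementary minors to
    the upper left block of [Z] and the lower right block of its inverse, as in
    [det_ulsubmx_mul]. *)
Lemma det_mxsub_invmx I J (hA : #|~: I| = r) (hI : #|I| = k) (hB : #|~: J| = r)
    (hJ : #|J| = k) (Z : 'M[R]_q) : Z \in unitmx ->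
  \det (mxsub (sel hI) (sel hJ) (invmx Z)) =
  (\det Z)^-1 * (ehat hA hI * ehat hB hJ * \det (mxsub (sel hB) (sel hA) Z)).
Proof.
move=> Zu; have dZ : \det Z != 0 by rewrite -unitfE -unitmxE.
have sI := sqr_det_basis_completion hA hI.
have sJ := sqr_det_basis_completion hB hJ.
have E : \det (mxsub (sel hB) (sel hA) Z) = ehat hB hJ * \det Z * ehat hA hI *
    \det (mxsub (sel hI) (sel hJ) (invmx Z)).
  clear sI sJ dZ; rewrite /basis_completion.
  case: q / hrk I J hA hI hB hJ Z Zu => I J hA hI hB hJ Z Zu; rewrite !castmx_id.
  set EI := row_mx (basis_mx R hA) _; set EJ := row_mx (basis_mx R hB) _.
  have EIE : EI^T *m EI = 1%:M := tr_row_basis_mul R hA hI.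
  have EJE : EJ^T *m EJ = 1%:M := tr_row_basis_mul R hB hJ.
  have HH' : (EJ^T *m Z *m EI) *m (EI^T *m invmx Z *m EJ) = 1%:M.
    rewrite !mulmxA -(mulmxA _ EI) (mulmx1C EIE) mulmx1 mulmxK //.
  have := det_ulsubmx_mul HH'; rewrite !det_mulmx !det_tr.
  rewrite {1}/EI {1}/EJ tr_row_mx mul_col_mx mul_col_row /ulsubmx col_mxKu row_mxKl.
  rewrite {2}/EI {2}/EJ tr_row_mx mul_col_mx mul_col_row /drsubmx col_mxKd row_mxKr.
  by rewrite !mul_basis_mx !tr_basis_mul_mx -!mxsub_comp.
rewrite E; set d := \det (mxsub _ _ _); set x := ehat _ _; set y := ehat _ _.
transitivity (((\det Z)^-1 * \det Z) * (x * x) * (y * y) * d).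
  by rewrite mulVf // sI sJ !mul1r.
ring.
Qed.

End Completion.

(** * Networks *)

(* The Gram case of [det_inv_compression]: with [K = U diag(w) U^T], the weights
   of the selected columns factor out of the second determinant. *)
Lemma det_inv_gram (F : fieldType) (n r p : nat) (hn : (r + p)%N = n)
    (I : finType) (w : I -> F) (u : I -> 'I_n -> F) (A B : 'M[F]_(n, r)) :
  let K := \matrix_(a, b) \sum_i w i * (u i a * u i b) in
  let M D (f : 'I_p -> I) :=
    castmx (erefl n, hn) (row_mx D (\matrix_(a, b) u (f b) a)) in
  K \in unitmx -> row_free A^T -> row_free B^T ->
  (\det K * \det (A^T *m invmx K *m B)) *+ p`! =
  \sum_(f : {ffun 'I_p -> I})
     (\prod_j w (f j)) * (\det (M A f) * \det (M B f)).
Proof.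
case: n / hn u A B => u A B K M Ku Afree Bfree.
have KE : K = \matrix_(a, b) \sum_i u i a * (w i * u i b).
  by apply/matrixP=> a b; rewrite !mxE; apply: eq_bigr => i _; rewrite mulrCA.
rewrite (det_inv_compression KE) //; apply: eq_bigr => f _.
rewrite /M !castmx_id mulrC mulrA; congr (_ * _).
have -> : col_mx A^T (\matrix_(a, b) (w (f a) * u (f a) b)) =
    block_mx 1%:M 0 0 (diag_mx (\row_j w (f j))) *m
    (row_mx A (\matrix_(a, b) u (f b) a))^T.
  rewrite tr_row_mx mul_block_col !mul0mx addr0 add0r mul1mx; congr col_mx.
  by apply/matrixP=> a b; rewrite mul_diag_mx !mxE.
rewrite det_mulmx det_tr det_ublock det1 mul1r det_diag.
by congr (_ * _); apply: eq_bigr => j _; rewrite mxE.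
Qed.

(** Bordering by [r] columns raises the rank by at most [r], so an invertible result needs
    independent columns in [X]. *)
Lemma det_row_mx_eq0 (F : fieldType) (n r p : nat) (hn : (r + p)%N = n)
    (B : 'M[F]_(n, r)) (X : 'M[F]_(n, p)) :
  ~~ row_free X^T -> \det (castmx (erefl n, hn) (row_mx B X)) = 0.
Proof.
apply: contraNeq; rewrite -unitfE -unitmxE castmx_unitE /row_free mxrank_tr.
move=> /eqP rM.
rewrite eqn_leq rank_leq_col -(leq_add2l r) {1}hn -[X in (X <= _)%N]rM.
rewrite -[X in (X <= _)%N]mxrank_tr tr_row_mx -addsmxE.
by rewrite (leq_trans (mxrank_adds_leqif _ _)) // !mxrank_tr leq_add2r rank_leq_col.
Qed.

(** This is the multiplicity of an edge set in the Cauchy-Binet sum over functions. *)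
Lemma card_inj_ffuns_imset (T : finType) (p : nat) (A : {set T}) : #|A| = p ->
  #|[set f : {ffun 'I_p -> T} | injectiveb f & [set f j | j : 'I_p] == A]| = p`!.
Proof.
move=> Ap; have := card_inj_ffuns_on 'I_p (mem A); rewrite Ap card_ord ffactnn => <-.
apply: eq_card => f; rewrite !inE andbC.
apply: andb_id2r => /injectiveP finj.
rewrite eqEcard card_imset // card_ord Ap leqnn andbT.
apply/subsetP/ffun_onP => [fA j|fA _ /imsetP[j _ ->]]; last exact: fA.
by apply: fA; apply: imset_f.
Qed.

(** * Forest expansion for the grounded Laplacian *)

Section NetworkTheory.
Variables (R : realFieldType) (V : finType) (E : {set {set V}}).
Variables (c : {set V} -> R) (g : V).

(** An arbitrary orientation of the edges; the default is not reached on [E]. *)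
Definition edge_arc (e : {set V}) : V * V :=
  odflt (g, g) [pick xy | e == [set xy.1; xy.2]].

Hypothesis Esimple : simple_graph E.

Lemma edge_arcE e : e \in E -> e = [set (edge_arc e).1; (edge_arc e).2].
Proof.
move=> /Esimple/eqP/cards2P[x [y [_ ->]]]; rewrite /edge_arc.
by case: pickP => [xy /eqP //|/(_ (x, y))]; rewrite eqxx.
Qed.

Lemma edge_arc_neq e : e \in E -> (edge_arc e).1 != (edge_arc e).2.
Proof.
move=> eE; have := Esimple eE; rewrite {1}(edge_arcE eE) cards2.
by case: eqVneq.
Qed.

(** Extending conductances by zero lets sums run over all vertex sets. *)
Let C e : R := if e \in E then c e else 0.
Let chain e v : R := (v == (edge_arc e).2)%:R - (v == (edge_arc e).1)%:R.

Lemma laplacian_gram u v :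
  laplacian E c u v = \sum_e C e * (chain e u * chain e v).
Proof.
rewrite /C (bigID (mem E)) /= [X in _ = _ + X]big1 ?addr0; last first.
  by move=> e /negPf->; rewrite mul0r.
under [RHS]eq_bigr => e eE do rewrite eE.
have chainE e : e \in E -> chain e u * chain e v =
    if u == v then (u \in e)%:R else - (e == [set u; v])%:R.
  move=> eE; move: (edge_arcE eE) (edge_arc_neq eE); rewrite /chain.
  case: (edge_arc e) => x y /= -> xy; rewrite !inE.
  have [<-|uv] := eqVneq u v.
    have [->|ux] := eqVneq u x; first by rewrite (negPf xy) sub0r mulrNN mulr1.
    by case: (u == y); rewrite subr0 ?mulr1 ?mul0r.
  have [ux|ux] := eqVneq u x.
    subst u; rewrite (negPf xy) sub0r mulN1r [v == x]eq_sym (negPf uv) subr0.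
    congr (- (nat_of_bool _)%:R); apply/eqP/eqP=> [-> //|/eq_set2[[] //|[xv _]]].
    by rewrite xv eqxx in uv.
  have [uy|uy] := eqVneq u y.
    subst u; rewrite subr0 mul1r [v == y]eq_sym (negPf uv) sub0r.
    congr (- (nat_of_bool _)%:R); apply/eqP/eqP=> [->|]; first by rewrite setUC.
    by move=> /eq_set2[[yx _]|[-> //]]; rewrite yx eqxx in xy.
  rewrite subrr mul0r; case: eqP => [/eq_set2[[xu _]|[_ yu]]|]; rewrite ?oppr0 //.
    by rewrite xu eqxx in ux.
  by rewrite yu eqxx in uy.
rewrite /laplacian; case: ifP => uv.
  rewrite big_mkcondr /=; apply: eq_bigr => e eE.
  by rewrite chainE // uv; case: (u \in e); rewrite (mulr1, mulr0).
have {chainE} -> : \sum_(e in E) c e * (chain e u * chain e v) =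
    \sum_(e in E) if e == [set u; v] then - c e else 0.
  apply: eq_bigr => e eE; rewrite chainE // uv.
  by case: eqP => _; rewrite ?mulrN1 // oppr0 mulr0.
case: ifP => uvE.
  by rewrite (bigD1 _ uvE) /= eqxx big1 ?addr0 // => e /andP[_ /negPf->].
by rewrite big1 // => e eE; case: eqP => // euv; rewrite -euv eE in uvE.
Qed.

Let K := grounded_laplacian E c g.
Let n := #|[set~ g]|.

Lemma grounded_laplacian_gram : K = \matrix_(a, b) \sum_e
  C e * (chain e (enum_val a) * chain e (enum_val b)).
Proof. by apply/matrixP=> a b; rewrite !mxE laplacian_gram. Qed.

Lemma tr_grounded_laplacian : K^T = K.
Proof.
rewrite grounded_laplacian_gram; apply/matrixP=> a b; rewrite !mxE.
by apply: eq_bigr => e _; rewrite [X in _ * X]mulrC.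
Qed.

Lemma chain_incidence p (f : 'I_p -> {set V}) :
  \matrix_(a, b) chain (f b) (enum_val a) = incidence (edge_arc \o f) R g.
Proof. by apply/matrixP=> a b; rewrite !mxE. Qed.

(** This is the Dirichlet energy of the potential, from writing [K] as a sum of rank-one matrices
    over the edges. *)
Lemma grounded_laplacian_form (y : 'rV[R]_n) : (y *m K *m y^T) 0 0 =
  \sum_(e in E) c e * (potential y (edge_arc e).2 - potential y (edge_arc e).1) ^+ 2.
Proof.
pose N e := incidence (edge_arc \o (fun _ : 'I_1 => e)) R g.
have -> : K = \sum_(e in E) c e *: (N e *m (N e)^T).
  rewrite grounded_laplacian_gram; apply/matrixP=> a b; rewrite mxE summxE.
  rewrite [RHS]big_mkcond; apply: eq_bigr => e _; rewrite /C.
  case: ifP; rewrite ?mul0r // => _; rewrite !mxE big_ord1; congr (_ * _).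
  by rewrite /N -chain_incidence !mxE.
rewrite mulmx_sumr mulmx_suml summxE; apply: eq_bigr => e _.
rewrite -scalemxAr -scalemxAl mxE; congr (_ * _).
rewrite !mulmxA -(mulmxA (y *m N e)) -trmx_mul mxE big_ord1 [X in _ * X]mxE.
by rewrite !mul_incidence expr2.
Qed.

Hypothesis Econnected : mg_connected id [set: V] E.
Hypothesis c_gt0 : forall f, f \in E -> 0 < c f.

(** With positive conductances, zero energy makes the potential constant along each edge;
    connectedness then carries the ground value 0 to every vertex. *)
Lemma grounded_laplacian_form_eq0 (y : 'rV[R]_n) :
  (y *m K *m y^T) 0 0 = 0 -> y = 0.
Proof.
rewrite grounded_laplacian_form => /psumr_eq0P yE.
have {}yE e : e \in E -> potential y (edge_arc e).2 = potential y (edge_arc e).1.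
  have sumE := yE (fun e eE => mulr_ge0 (ltW (c_gt0 eE)) (sqr_ge0 _)).
  move=> eE; have /eqP := sumE e eE.
  by rewrite mulf_eq0 gt_eqF ?c_gt0 //= sqrf_eq0 subr_eq0 => /eqP.
apply: (@potential_inj _ _ g) => v; rewrite potential0 -(potential_ground y).
apply: (@mg_connect_eq _ _ id _ E) => [e a b eE|].
  by rewrite {1}(edge_arcE eE) => /eq_set2[[<- <-]|[<- <-]]; rewrite yE.
by move/forallP/(_ v): Econnected; rewrite inE => /forallP/(_ g); rewrite inE.
Qed.

Lemma grounded_laplacian_unit : K \in unitmx.
Proof.
rewrite -row_free_unit; apply: inj_row_free => y yK.
by apply: grounded_laplacian_form_eq0; rewrite yK mul0mx mxE.
Qed.

(** If [x *m Z = 0], the potential [y] induced by the injected current has energy [x Z x^T = 0], so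
    [y] vanishes, then the current, then [x] by independence of the dipoles. *)
Lemma impedance_unit q (P : 'I_q -> V * V) :
  row_free (incidence P R g)^T -> impedance P g E c \in unitmx.
Proof.
move=> Pfree; rewrite -row_free_unit; apply: inj_row_free => x xZ.
set D := incidence P R g in Pfree; pose y := x *m D^T *m invmx K.
have yK : y *m K = x *m D^T by rewrite mulmxKV // grounded_laplacian_unit.
apply/eqP; rewrite -(mulmx_free_eq0 _ Pfree) -yK.
suff -> : y = 0 by rewrite mul0mx.
apply: grounded_laplacian_form_eq0; rewrite yK /y !trmx_mul trmx_inv.
rewrite tr_grounded_laplacian trmxK !mulmxA.
by have := xZ; rewrite /impedance !mulmxA => ->; rewrite mul0mx mxE.
Qed.

Variable Co : {set {set V}} -> seq {set V}.
Hypothesis CoP : forall F, spanning_forest E F -> component_order g F (Co F).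

Lemma forestsP r F : F \in forests E r.+1 ->
  [/\ F \subset E, mg_acyclic id F, component_order g F (Co F),
      #|components F| = r.+1 & (r + #|F|)%N = n].
Proof.
rewrite inE => /andP[FE /eqP Fr]; have sP := CoP FE; case/andP: (FE) => FsE acF.
split=> //; apply/eqP.
rewrite -(@acyclic_forestE R _ g F _ r sP Fr edge_arc _ (@enum_val _ (mem F))) //.
- exact: enum_val_inj.
- by apply/setP=> e; apply/idP/imsetP=> [eF|[j _ ->]];
    [exists (enum_rank_in eF e); rewrite ?enum_rankK_in | apply: enum_valP].
- by move=> j; apply: edge_arcE; apply: (subsetP FsE); apply: enum_valP.
Qed.

(** In the Cauchy-Binet sum over functions, only the enumerations of acyclic subsets of [E] with [p]
    edges survive. Each such forest is enumerated [p] factorial times, a factor cancelled in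
    characteristic 0. *)
Lemma det_forest_expansion r (a b : 'I_r -> V * V) :
  row_free (incidence a R g)^T -> row_free (incidence b R g)^T ->
  \det K * \det ((incidence a R g)^T *m invmx K *m incidence b R g) =
  \sum_(F in forests E r.+1)
    \det (quotient_mx R g r (Co F) *m incidence a R g) *
    \det (quotient_mx R g r (Co F) *m incidence b R g) * weight c F.
Proof.
move=> afree bfree; set S := RHS; pose p := (n - r)%N.
have hn : (r + p)%N = n.
  by rewrite subnKC // -(eqP afree) rank_leq_col.
have p0 : p`!%:R != 0 :> R by rewrite pnatr_eq0 -lt0n fact_gt0.
apply: (mulIf p0); rewrite !mulr_natr.
have Ku := grounded_laplacian_unit; rewrite grounded_laplacian_gram in Ku *.
rewrite (det_inv_gram hn Ku) //.
pose term F := \det (quotient_mx R g r (Co F) *m incidence a R g) *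
    \det (quotient_mx R g r (Co F) *m incidence b R g) * weight c F.
have termE (f : {ffun 'I_p -> {set V}}) :
    (\prod_j C (f j)) *
     (\det (castmx (erefl n, hn) (row_mx (incidence a R g)
        (\matrix_(i, j) chain (f j) (enum_val i)))) *
      \det (castmx (erefl n, hn) (row_mx (incidence b R g)
        (\matrix_(i, j) chain (f j) (enum_val i))))) =
    \sum_(F in forests E r.+1 |
            injectiveb f && ([set f j | j : 'I_p] == F)) term F.
  set im := [set f j | j : 'I_p]; rewrite chain_incidence.
  have [finj|fninj] /= := boolP (injectiveb f); last first.
    rewrite (det_row_mx_eq0 _ (incidence a R g)) ?mul0r ?mulr0.
      by rewrite big_pred0 // => F; rewrite andbF.
    apply: contra fninj => Xfree; apply/injectiveP=> i j fij.
    have /matrixP/(_ 0 j) : delta_mx 0 i = delta_mx 0 j :> 'rV[R]_p.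
      apply: (row_free_inj Xfree); rewrite -!rowE.
      by apply/matrixP=> ? ?; rewrite !mxE /= fij.
    rewrite !mxE !eqxx /=; case: eqP => // _ /eqP; rewrite eq_sym oner_eq0 //.
  move/injectiveP: finj => finj.
  have [imE|/subsetPn[_ /imsetP[j _ ->] fjE]] := boolP (im \subset E); last first.
    rewrite (bigD1 j) //= {1}/C (negPf fjE) !mul0r big_pred0 // => F.
    apply/negP=> /andP[/forestsP[FE _ _ _ _] /eqP imF].
    by case/negP: fjE; apply: (subsetP FE); rewrite -imF imset_f.
  have arcE j : f j = [set (edge_arc (f j)).1; (edge_arc (f j)).2].
    by apply: edge_arcE; apply: (subsetP imE); apply: imset_f.
  have [acim|acim] := boolP (mg_acyclic id im); last first.
    rewrite (det_row_mx_eq0 _ (incidence a R g)) ?mul0r ?mulr0.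
      rewrite big_pred0 // => F; apply/negP=> /andP[/forestsP[_ acF _ _ _] /eqP imF].
      by rewrite imF acF in acim.
    by rewrite (@incidence_free R _ g _ id edge_arc p f finj arcE).
  have sP : component_order g im (Co im) by apply: CoP; apply/andP.
  have [r' r'1] : exists r', #|components im| = r'.+1.
    have : (0 < #|components im|)%N.
      by apply/card_gt0P; exists (component im g); apply: component_in.
    by case: #|_| => // r' _; exists r'.
  (* The edge count fixes the number of components: [r' + p] and [r + p] both equal the number of
     nonground vertices. *)
  have := @acyclic_forestE R _ g im _ r' sP r'1 edge_arc p f finj erefl arcE.
  rewrite acim => /esym/eqP; rewrite -[RHS]hn => /addIn rr; subst r'.
  have imF : im \in forests E r.+1 by rewrite inE r'1 eqxx andbT; apply/andP.
  rewrite (big_pred1 im) => [|F]; last first.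
    rewrite [RHS]eq_sym /=; case: (im =P F) => [<-|]; rewrite ?imF ?andbF //.
  have [e ee eE] := @det_row_forest R _ g im _ r sP r'1 edge_arc p f erefl arcE hn.
  rewrite !eE mulrACA ee mul1r mulrC /term; congr (_ * _ * _).
  rewrite /weight big_imset /=; last by move=> ? ? _ _ /finj.
  by apply: eq_bigr => j _; rewrite /C (subsetP imE) // imset_f.
rewrite (eq_bigr _ (fun f _ => termE f)) /S.
rewrite (exchange_big_dep (mem (forests E r.+1))) /=; last by move=> f F _ /andP[].
rewrite -sumrMnl; apply: eq_bigr => F FF; rewrite FF /=.
have [_ _ _ _ Fn] := forestsP FF.
have Fp : #|F| = p by rewrite /p -Fn addKn.
rewrite -(card_inj_ffuns_imset Fp) -sumr_const.
by apply: eq_bigl => f; rewrite inE.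
Qed.

Lemma tauE : tau E c = \det K.
Proof.
pose a := fun _ : 'I_0 => (g, g).
have free0 : row_free (incidence a R g)^T.
  by rewrite /row_free -leqn0 rank_leq_row.
have := det_forest_expansion free0 free0; rewrite det_mx00 mulr1 => ->.
apply: eq_big => [T|T _]; last by rewrite !det_mx00 !mul1r.
(* Being connected means having a single component, so forests with one component are the spanning
   trees. *)
rewrite inE /spanning_forest /mg_spanning_tree -andbA; congr (_ && _).
rewrite andbC; congr (_ && _); apply/idP/cards1P=> [conn|[X XE]].
  exists (component T g); apply/setP=> X; rewrite inE.
  apply/imsetP/eqP=> [[v _ ->]|->]; last by exists g.
  apply/eqP; rewrite component_eq.
  by move/forallP/(_ v): conn; rewrite inE => /forallP/(_ g); rewrite inE.
apply/forallP=> u; apply/implyP=> _; apply/forallP=> v; apply/implyP=> _.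
rewrite -component_eq; have := component_in T u; have := component_in T v.
by rewrite XE !inE => /eqP-> /eqP->.
Qed.

End NetworkTheory.

(** * Minors of the impedance matrix and of its inverse *)

Lemma virtual_incidence_free (R : realFieldType) (V : finType) (g : V) (q r : nat)
    (P : 'I_q -> V * V) (phi : 'I_r -> 'I_q) :
  mg_acyclic (virtual_ends P) [set: 'I_q] -> injective phi ->
  row_free (incidence (P \o phi) R g)^T.
Proof.
move=> acP phi_inj.
rewrite (@incidence_free R _ g _ (virtual_ends P) P _ phi phi_inj) //.
exact: mg_acyclicS (subsetT _) acP.
Qed.

Lemma chiE (R : realFieldType) (V : finType) (g : V) (q r : nat)
    (P : 'I_q -> V * V) s (A : {set 'I_q}) (hA : #|A| = r) :
  chi P R g s hA = \det (quotient_mx R g r s *m incidence (P \o sel hA) R g).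
Proof.
rewrite /chi /boundary_mx -mulmx_colsub; congr (\det (_ *m _)).
by apply/matrixP=> i j; rewrite !mxE.
Qed.

Theorem theorem6p1 (R : realFieldType) (V : finType) (E : {set {set V}})
    (c : {set V} -> R) (g : V) (q : nat) (P : 'I_q -> V * V)
    (C : {set {set V}} -> seq {set V})
    (Esimple : simple_graph E)
    (Econnected : mg_connected id [set: V] E)
    (c_gt0 : forall f, f \in E -> 0 < c f)
    (Pacyclic : mg_acyclic (virtual_ends P) [set: 'I_q])
    (C_order : forall F, spanning_forest E F -> component_order g F (C F)) :
  let Z := impedance P g E c in
  let L := invmx Z in
  (* well-definedness of the inverses and quotients below *)
  [/\ grounded_laplacian E c g \in unitmx, tau E c != 0,
      Z \in unitmx & Phi P E c != 0] /\
  [/\ forall (r : nat) (A B : {set 'I_q}) (hA : #|A| = r) (hB : #|B| = r),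
        \det (mxsub (sel hA) (sel hB) Z) =
        (tau E c)^-1 * \sum_(F in forests E r.+1)
           chi P R g (C F) hA * chi P R g (C F) hB * weight c F,
      forall (k r : nat) (hrk : (r + k)%N = q) (I J : {set 'I_q})
          (hI : #|I| = k) (hJ : #|J| = k),
        \det (mxsub (sel hI) (sel hJ) L) =
        (Phi P E c)^-1 * \sum_(F in forests E r.+1)
           chihat P R g (C F) hrk hI * chihat P R g (C F) hrk hJ * weight c F,
      forall (r : nat) (A B : {set 'I_q}) (hA : #|A| = r) (hB : #|B| = r)
          (F : {set {set V}}), F \in forests E r.+1 ->
        chi P R g (C F) hA * chi P R g (C F) hB \in [:: 0; 1; -1],
      forall (k r : nat) (hrk : (r + k)%N = q) (I J : {set 'I_q})
          (hI : #|I| = k) (hJ : #|J| = k) (F : {set {set V}}),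
          F \in forests E r.+1 ->
        chihat P R g (C F) hrk hI * chihat P R g (C F) hrk hJ
          \in [:: 0; 1; -1]
    & forall (k r : nat) (hrk : (r + k)%N = q) (I : {set 'I_q})
          (hI : #|I| = k) (F : {set {set V}}), F \in forests E r.+1 ->
        (chihat P R g (C F) hrk hI != 0) = quotient_spanning_tree P F (~: I)].
Proof.
set K := grounded_laplacian E c g => Z L.
have Ku : K \in unitmx := grounded_laplacian_unit g Esimple Econnected c_gt0.
have dK : \det K != 0 by rewrite -unitfE -unitmxE.
have tauK : tau E c = \det K := tauE Esimple Econnected c_gt0 C_order.
have Pfree r (phi : 'I_r -> 'I_q) : injective phi ->
    row_free (incidence (P \o phi) R g)^T := virtual_incidence_free R g Pacyclic.
have Pfree1 : row_free (incidence P R g)^T := Pfree _ id (fun _ _ => id).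
have Zu : Z \in unitmx := impedance_unit Esimple Econnected c_gt0 Pfree1.
have dZ : \det Z != 0 by rewrite -unitfE -unitmxE.
have minorZ r (A B : {set 'I_q}) (hA : #|A| = r) (hB : #|B| = r) :
    \det (mxsub (sel hA) (sel hB) Z) = (tau E c)^-1 *
    \sum_(F in forests E r.+1) chi P R g (C F) hA * chi P R g (C F) hB * weight c F.
  apply: (canRL (mulKf _)); rewrite tauK //.
  under [RHS]eq_bigr => F _ do rewrite !chiE.
  rewrite -(det_forest_expansion Esimple Econnected c_gt0 C_order);
    try exact: Pfree (@sel_inj _ _ _ _).
  congr (_ * \det _); rewrite /Z /impedance mxsub_mul -mul_rowsub_mx.
  by congr (_ *m _ *m _); apply/matrixP=> i j; rewrite !mxE.
have forestP r F (FF : F \in forests E r.+1) := forestsP R Esimple C_order FF.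
have quotientE r F (phi : 'I_r -> 'I_q) : F \in forests E r.+1 -> injective phi ->
    (\det (quotient_mx R g r (C F) *m incidence (P \o phi) R g) != 0) =
    quotient_spanning_tree P F [set phi j | j : 'I_r].
  by move=> /forestP[_ _ sP r1 _] /(quotient_spanning_treeE R sP r1).
have chi_mem r F (A : {set 'I_q}) (hA : #|A| = r) : F \in forests E r.+1 ->
    chi P R g (C F) hA \in [:: 0; 1; -1].
  move=> /forestP[_ _ sP r1 _]; rewrite chiE.
  exact: (det_quotient_incidence R sP r1).
(* In the forest expansion with all [q] dipoles, each determinant is 0 or a sign, so its square is
   the indicator that [E(P)] is a spanning tree of the quotient. *)
have PhiE : Phi P E c = tau E c * \det Z.
  rewrite tauK /Z /impedance.
  rewrite (det_forest_expansion Esimple Econnected c_gt0 C_order Pfree1 Pfree1).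
  rewrite /Phi big_mkcondr; apply: eq_bigr => F FF.
  have [_ _ sP r1 _] := forestP _ _ FF.
  have := det_quotient_incidence R sP r1 P.
  have -> : [set: 'I_q] = [set id j | j : 'I_q].
    by apply/setP=> j; rewrite inE; apply/esym/imsetP; exists j.
  rewrite -quotientE //.
  rewrite !inE -[P \o id]/P; case: eqP => [->|_] /=; first by rewrite !mul0r.
  by case/orP=> /eqP->; rewrite ?mulrNN mulr1 mul1r.
have card_compl k r (hrk : (r + k)%N = q) (I : {set 'I_q}) : #|I| = k -> #|~: I| = r.
  by move=> hI; rewrite cardsCs setCK hI card_ord -hrk addnK.
have chihatE k r (hrk : (r + k)%N = q) (I : {set 'I_q}) (hA : #|~: I| = r)
    (hI : #|I| = k) F : chihat P R g (C F) hrk hI =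
    \det (basis_completion R hrk hA hI) * chi P R g (C F) hA.
  exact: det_completion.
have signE k r (hrk : (r + k)%N = q) (I : {set 'I_q}) (hA : #|~: I| = r)
    (hI : #|I| = k) := sqr_det_basis_completion R hrk hA hI.
have chihat_mem k r (hrk : (r + k)%N = q) (I : {set 'I_q}) (hI : #|I| = k) F :
    F \in forests E r.+1 -> chihat P R g (C F) hrk hI \in [:: 0; 1; -1].
  move=> FF; have hA := card_compl _ _ hrk _ hI.
  rewrite (chihatE _ _ _ _ hA); apply: mem_01N1_mul (chi_mem _ _ _ _ FF).
  have /eqP := signE _ _ hrk _ hA hI; rewrite -expr2 sqrf_eq1 !inE.
  by move=> ->; rewrite orbT.
split; first by rewrite tauK PhiE mulf_neq0 ?tauK.
split=> //.
- move=> k r hrk I J hI hJ.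
  have hA := card_compl _ _ hrk _ hI; have hB := card_compl _ _ hrk _ hJ.
  rewrite (det_mxsub_invmx hrk hA hI hB hJ Zu) minorZ PhiE invfM.
  pose eIJ := \det (basis_completion R hrk hA hI) *
              \det (basis_completion R hrk hB hJ).
  (* Jacobi's identity exchanges rows and columns, so the complement of [J] comes first;
     commutativity of the products restores the order. *)
  transitivity ((tau E c)^-1 / \det Z * (eIJ * \sum_(F in forests E r.+1)
     chi P R g (C F) hB * chi P R g (C F) hA * weight c F)).
    by rewrite /eIJ; ring.
  congr (_ * _); rewrite mulr_sumr; apply: eq_bigr => F _.
  by rewrite (chihatE _ _ _ _ hA) (chihatE _ _ _ _ hB) /eIJ; ring.
- by move=> r A B hA hB F FF; apply: mem_01N1_mul; apply: chi_mem.
- by move=> k r hrk I J hI hJ F FF; apply: mem_01N1_mul; apply: chihat_mem.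
move=> k r hrk I hI F FF; have hA := card_compl _ _ hrk _ hI.
rewrite (chihatE _ _ _ _ hA) mulf_eq0 negb_or -[in RHS](imset_sel hA).
rewrite -quotientE //; last exact: sel_inj.
(* The shuffle sign squares to 1 and is therefore nonzero. *)
rewrite chiE andb_idl // => _; apply: contra_eq_neq (signE _ _ hrk _ hA hI).
by move=> ->; rewrite mul0r eq_sym oner_neq0.
Qed.
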